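(* Let $G$ be an abelian group. For any subset $S\subset\mathcal P_G$ and any abelian group $A$, there are exact sequences $$0\longrightarrow\frac{\mathrm{Hom}(\mathcal I_S,A)}{\mathrm B^2_S(A)}\longrightarrow\mathrm H^2_S(A)\longrightarrow\mathrm{Hom}(\mathcal K_S,A)\longrightarrow0,$$ $$\mathrm{Ext}(G,A)\longrightarrow\frac{\mathrm{Hom}(\mathcal I_S,A)}{\mathrm B^2_S(A)}\longrightarrow\mathrm{Ext}(\mathcal C_S,A)\longrightarrow0,$$ where the kernel of the map $\mathrm{Ext}(G,A)\to\mathrm{Hom}(\mathcal I_S,A)/\mathrm B^2_S(A)$ consists of the classes of symmetric two-cocycles whose restriction to $S$ is in $\mathrm B^2_S(A)$. Moreover, the first sequence is split.
   Context: $G$ is written multiplicatively. $\mathcal P_G$ is the set of unordered pairs $\{g,h\}$ of elements of $G$ (with $g=h$ allowed). $\mathcal F_G$ is the free abelian group (written multiplicatively) on $\mathcal P_G$, and $\mathcal R_G\subset\mathcal F_G$ is the set of all elements $\{g,h\}\{gh,k\}\{h,k\}^{-1}\{g,hk\}^{-1}$ with $g,h,k\in G$. For $S\subset\mathcal P_G$, $\mathcal F_S\subset\mathcal F_G$ is the free abelian group on $S$ and $\mathcal R_S:=\mathcal R_G\cap\mathcal F_S$. Put $\mathcal Z_S:=\mathcal F_S/\langle\mathcal R_S\rangle$ and $\mathcal Z_G:=\mathcal F_G/\langle\mathcal R_G\rangle$. Let $f\colon\mathcal Z_S\to\mathcal Z_G$ be the homomorphism induced by the inclusion $\mathcal F_S\hookrightarrow\mathcal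 F_G$, and $\mathcal K_S:=\ker f$, $\mathcal I_S:=\operatorname{im}f$, $\mathcal C_S:=\operatorname{coker}f$. For an abelian group $A$ (trivial $G$-action, written multiplicatively), $\mathrm Z^2_{\rm sym}(G,A)$ is the group of symmetric two-cocycles $G\times G\to A$, identified with $\mathrm{Hom}(\mathcal Z_G,A)$, and $\mathrm B^2(G,A)$ is the subgroup of coboundaries $d\alpha(g,h)=\alpha(g)\alpha(h)\alpha(gh)^{-1}$ for arbitrary maps $\alpha\colon G\to A$; $\mathrm{Ext}(G,A)=\mathrm{Ext}_{\mathbb Z}(G,A)$ is identified with $\mathrm Z^2_{\rm sym}(G,A)/\mathrm B^2(G,A)$. $\mathrm B^2_S(A)$ is the image of $\mathrm B^2(G,A)$ under restriction of functions from $\mathcal P_G$ to $S$, a subgroup of $\mathrm{Fun}(S,A)=\mathrm{Hom}(\mathcal F_S,A)$; it lies in $\mathrm{Hom}(\mathcal Z_S,A)$ and in fact in $\mathrm{Hom}(\mathcal I_S,A)$, which is regarded as a subgroup of $\mathrm{Hom}(\mathcal Z_S,A)$ via composition with $f$. $\mathrm H^2_S(A):=\mathrm{Hom}(\mathcal Z_S,A)/\mathrm B^2_S(A)$. In the first sequence the maps are induced by composition with $f$ and by restriction to $\mathcal K_S$. In the second, the first map is induced by restriction $\mathrm{Hom}(\mathcal Z_G,A)\to\mathrm{Hom}(\mathcal I_S,A)$ (i.e. restriction of symmetric two-cocycles to $S$), and the second by the connecting homomorphism $\mathrm{Hom}(\mathcal I_S,A)\to\mathrm{Ext}(\mathcal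 C_S,A)$ of the short exact sequence $0\to\mathcal I_S\to\mathcal Z_G\to\mathcal C_S\to0$. *)

(* Defs.v *)
(* Abelian groups, multiplicative in the source, are written additively.     *)
From HB Require Import structures.
From mathcomp Require Import all_boot all_algebra.
From mathcomp Require Import boolp classical_sets functions.
From mathcomp Require Import freeg.
Set Implicit Arguments.
Unset Strict Implicit.
Unset Printing Implicit Defensive.
Import GRing.Theory.
Local Open Scope ring_scope.
Local Open Scope quotient_scope.
Local Open Scope classical_set_scope.

Definition subgroup_set (U : zmodType) (P : set U) : Prop :=
  P 0 /\ forall x y, P x -> P y -> P (x - y).

Lemma zsub_closed (U : zmodType) (P : set U) :
  subgroup_set P -> zmod_closed (fun x => `[< P x >]).
Proof.
case=> P0 PB; split=> [|x y]; first exact/asboolP.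
by move=> /asboolP Px /asboolP Py; apply/asboolP/PB.
Qed.

Definition zsub (U : zmodType) (P : set U) (hP : subgroup_set P) :
    zmodClosed U :=
  HB.pack (fun x => `[< P x >])
    (GRing.isZmodClosed.Build U (fun x => `[< P x >]) (zsub_closed hP)).

Lemma zsubP (U : zmodType) (P : set U) (hP : subgroup_set P) x :
  reflect (P x) (x \in zsub hP).
Proof. exact: asboolP. Qed.

Definition subgrp (U : zmodType) (H : zmodClosed U) : Type := {x : U | x \in H}.

HB.instance Definition _ (U : zmodType) (H : zmodClosed U) :=
  SubChoice.on (subgrp H).
HB.instance Definition _ (U : zmodType) (H : zmodClosed U) :=
  [SubChoice_isSubZmodule of subgrp H by <:].

Definition in_subgrp (U : zmodType) (H : zmodClosed U) x (hx : x \in H) :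
  subgrp H := exist _ x hx.

Section Generated.
Variables (U : zmodType) (X : set U).

Definition gen_set : set U :=
  [set x | forall H : zmodClosed U, (forall y, X y -> y \in H) -> x \in H].

Lemma gen_set_subgroup : subgroup_set gen_set.
Proof.
split=> [H _|x y hx hy H hH]; first exact: rpred0.
by rewrite rpredB ?hx ?hy.
Qed.

Definition gen_group : zmodClosed U := zsub gen_set_subgroup.

Lemma mem_gen x : X x -> x \in gen_group.
Proof. by move=> Xx; apply/zsubP => H; apply. Qed.

Lemma gen_min (H : zmodClosed U) x :
  (forall y, X y -> y \in H) -> x \in gen_group -> x \in H.
Proof. by move=> XH /zsubP/(_ H XH). Qed.

End Generated.

Section KernelImage.
Variables (U V : zmodType) (f : {additive U -> V}).

Lemma ker_subgroup : subgroup_set [set x | f x = 0].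
Proof.
split=> [|x y /= fx fy]; first by rewrite /= raddf0.
by rewrite raddfB fx fy subr0.
Qed.

Definition ker_group : zmodClosed U := zsub ker_subgroup.

Lemma kerP x : reflect (f x = 0) (x \in ker_group).
Proof. exact: zsubP. Qed.

Lemma im_subgroup : subgroup_set (range f).
Proof.
split; first by exists 0; rewrite ?raddf0.
by move=> _ _ [x _ <-] [y _ <-]; exists (x - y); rewrite ?raddfB.
Qed.

Definition im_group : zmodClosed V := zsub im_subgroup.

Lemma imP y : reflect (exists x, y = f x) (y \in im_group).
Proof. by apply: (iffP (zsubP _ _)) => [[x _ <-]|[x ->]]; exists x. Qed.

Lemma preim_subgroup (H : zmodClosed V) : subgroup_set [set x | f x \in H].
Proof.
split=> [|x y /= fx fy]; first by rewrite /= raddf0 rpred0.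
by rewrite raddfB rpredB.
Qed.

Definition preim_group (H : zmodClosed V) : zmodClosed U := zsub (preim_subgroup H).

Lemma mem_preim (H : zmodClosed V) x : (x \in preim_group H) = (f x \in H).
Proof. by apply/zsubP/idP. Qed.

End KernelImage.

Definition exact_at (U V W : zmodType)
  (f : {additive U -> V}) (g : {additive V -> W}) := im_group f =i ker_group g.

Definition onto (U V : Type) (f : U -> V) := forall y, exists x, f x = y.

Definition split_epi (U V : zmodType) (g : {additive U -> V}) :=
  exists s : {additive V -> U}, cancel s g.

Definition mk_additive (U V : zmodType) (f : U -> V) (hf : zmod_morphism f) :
    {additive U -> V} :=
  HB.pack f (GRing.isZmodMorphism.Build U V f hf).

Notation "{ 'quot' H }" := (@Quotient.quot _ H) : type_scope.

Definition cls (U : zmodType) (H : zmodClosed U) : {additive U -> {quot H}} :=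
  \pi_({quot H}).

Lemma cls_eq (U : zmodType) (H : zmodClosed U) x y :
  (cls H x = cls H y) <-> (x - y \in H).
Proof. by rewrite Quotient.idealrBE; split=> [/eqP|/eqP]. Qed.

Lemma cls_repr (U : zmodType) (H : zmodClosed U) (q : {quot H}) :
  cls H (repr q) = q.
Proof. exact: reprK. Qed.

Section QuotientLift.
Variables (U V : zmodType) (H : zmodClosed U) (f : {additive U -> V}).
Hypothesis fH : forall x, x \in H -> f x = 0.

Lemma qlift_subproof x : f (repr (cls H x)) = f x.
Proof. by apply/subr0_eq; rewrite -raddfB fH //; apply/cls_eq/cls_repr. Qed.

Lemma qlift_additive : zmod_morphism (fun q : {quot H} => f (repr q)).
Proof.
move=> x y; rewrite -[x]cls_repr -[y]cls_repr -raddfB !qlift_subproof.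
exact: raddfB.
Qed.

Definition qlift : {additive {quot H} -> V} := mk_additive qlift_additive.

Lemma qliftE x : qlift (cls H x) = f x.
Proof. exact: qlift_subproof. Qed.

End QuotientLift.

Definition Hom (U A : zmodType) : Type := {additive U -> A}.

Section HomGroup.
Variables U A : zmodType.
Implicit Types f g h : Hom U A.

Lemma hom_eq f g : (forall x, f x = g x) -> f = g.
Proof.
case: f g => [f [[pf]]] [g [[pg]]] /= fg.
have {}fg : f = g by apply/funext.
by rewrite fg in pf *; rewrite (Prop_irrelevance pf pg).
Qed.

HB.instance Definition _ := gen_eqMixin (Hom U A).
HB.instance Definition _ := gen_choiceMixin (Hom U A).

Definition hom_zero : Hom U A := (\0 : U -> A).
Definition hom_opp f : Hom U A := \- f.
Definition hom_add f g : Hom U A := f \+ g.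

Lemma hom_addA : associative hom_add.
Proof. by move=> f g h; apply: hom_eq => x /=; rewrite addrA. Qed.
Lemma hom_addC : commutative hom_add.
Proof. by move=> f g; apply: hom_eq => x /=; rewrite addrC. Qed.
Lemma hom_add0 : left_id hom_zero hom_add.
Proof. by move=> f; apply: hom_eq => x /=; rewrite add0r. Qed.
Lemma hom_addN : left_inverse hom_zero hom_opp hom_add.
Proof. by move=> f; apply: hom_eq => x /=; rewrite addNr. Qed.

HB.instance Definition _ :=
  GRing.isZmodule.Build (Hom U A) hom_addA hom_addC hom_add0 hom_addN.

End HomGroup.

Section Precomposition.
Variables (U V A : zmodType) (f : {additive U -> V}).

Lemma precomp_additive :
  zmod_morphism (fun phi : Hom V A => (phi \o f : {additive U -> A}) : Hom U A).
Proof. by move=> phi psi; apply: hom_eq. Qed.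

Definition precomp : {additive Hom V A -> Hom U A} :=
  mk_additive precomp_additive.

End Precomposition.

Section UnorderedPairs.
Variable G : choiceType.

Definition swap_rel (x y : G * G) := (x == y) || (x == (y.2, y.1)).

Lemma swap_rel_equiv : equiv_class_of swap_rel.
Proof.
split=> [x|[a b] [c d]|[a b] [c d] [e f]]; first by rewrite /swap_rel eqxx.
- rewrite /swap_rel /= !xpair_eqE (eq_sym a c) (eq_sym b d) (eq_sym a d).
  by rewrite (eq_sym b c) (andbC (d == a)).
- by case/orP=> /eqP[-> ->] /orP[]/eqP[-> ->]; rewrite /swap_rel eqxx ?orbT.
Qed.

Canonical swap_equiv := EquivRelPack swap_rel_equiv.

(* Unordered pairs {g, h}, with g = h allowed. *)
Definition upairs := {eq_quot swap_rel}.
HB.instance Definition _ := Choice.on upairs.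
HB.instance Definition _ := EqQuotient.on upairs.

Definition upair (g h : G) : upairs := \pi_upairs (g, h).

Lemma upair_eq g h k l :
  (upair g h = upair k l) <-> (g = k /\ h = l) \/ (g = l /\ h = k).
Proof.
split=> [/eqP|]; first rewrite /upair piE => /orP[/eqP[-> ->]|/eqP[-> ->]].
- by left.
- by right.
by move=> gh; apply/eqP; rewrite /upair piE /=; case: gh => -[-> ->];
  rewrite /swap_rel eqxx ?orbT.
Qed.

Lemma upair_ind (P : upairs -> Prop) : (forall g h, P (upair g h)) -> forall p, P p.
Proof. by move=> hP p; rewrite -[p]reprK; case: (repr p). Qed.

(* Meaningful for symmetric c only (lemma on_upairE). *)
Definition on_upair (T : Type) (c : G -> G -> T) (p : upairs) : T :=
  c (repr p).1 (repr p).2.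

Lemma on_upairE (T : Type) (c : G -> G -> T) :
  (forall g h, c g h = c h g) -> forall g h, on_upair c (upair g h) = c g h.
Proof.
move=> cC g h; rewrite /on_upair; case: (repr _) (reprK (upair g h)) => k l.
by case/upair_eq=> -[-> ->].
Qed.

End UnorderedPairs.

Section Cocycles.
Variables G A : zmodType.

Definition sym_cocycle (c : G -> G -> A) : Prop :=
  (forall g h, c g h = c h g) /\
  (forall g h k, c g h + c (g + h) k = c h k + c g (h + k)).

Lemma sym_cocycle_subgroup : subgroup_set [set c | sym_cocycle c].
Proof.
split=> [//|c d [cC cE] [dC dE]].
have E x y : (c - d) x y = c x y - d x y by [].
split=> [g h|g h k]; first by rewrite !E cC dC.
by rewrite !E addrACA -opprD cE dE opprD addrACA.
Qed.

Definition sym_cocycles : zmodClosed (G -> G -> A) := zsub sym_cocycle_subgroup.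

Definition Z2sym : zmodType := subgrp sym_cocycles.

Definition cocycle (c : Z2sym) : G -> G -> A := val c.

Lemma cocycleP (c : Z2sym) : sym_cocycle (cocycle c).
Proof. by apply/(zsubP sym_cocycle_subgroup); exact: (valP c). Qed.

Definition mk_cocycle (c : G -> G -> A) (hc : sym_cocycle c) : Z2sym :=
  in_subgrp (introT (zsubP sym_cocycle_subgroup c) hc).

Definition cobound_fun (alpha : G -> A) (g h : G) : A :=
  alpha g + alpha h - alpha (g + h).

Lemma cobound_sym_cocycle alpha : sym_cocycle (cobound_fun alpha).
Proof.
rewrite /cobound_fun; split=> [g h|g h k].
  by rewrite (addrC g) (addrC (alpha g)).
rewrite -(addrA (alpha (g + h))) subrKA (addrC (alpha g) (alpha (h + k))).
rewrite -(addrA (alpha (h + k))) subrKA addrA [RHS]addrA [g + (h + k)]addrA.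
by rewrite [alpha h + _ + _]addrC addrA.
Qed.

Definition cobound (alpha : G -> A) : Z2sym :=
  mk_cocycle (cobound_sym_cocycle alpha).

Lemma coboundB alpha beta : cobound (alpha - beta) = cobound alpha - cobound beta.
Proof.
apply/val_inj/funext=> g; apply/funext=> h.
change (alpha g - beta g + (alpha h - beta h) - (alpha (g + h) - beta (g + h)) =
  (alpha g + alpha h - alpha (g + h)) - (beta g + beta h - beta (g + h))).
by rewrite addrACA -opprD (opprD (alpha (g + h))) addrACA -(opprD (beta g + _)).
Qed.

Lemma B2_subgroup : subgroup_set (range cobound).
Proof.
split; first exists 0 => //.
  apply/val_inj/funext=> g; apply/funext=> h.
  by change (0 + 0 - 0 = 0 :> A); rewrite subr0 addr0.
by move=> _ _ [a _ <-] [b _ <-]; exists (a - b) => //; rewrite coboundB.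
Qed.

Definition B2 : zmodClosed Z2sym := zsub B2_subgroup.

(* Ext_Z(G, A), as classes of symmetric two-cocycles (factor sets). *)
Definition Ext : zmodType := {quot B2}.

End Cocycles.

Section FreeGroupLift.
Variables (K : choiceType) (A : zmodType).

Definition free_lift (u : K -> A) : {additive {freeg K} -> A} :=
  mk_additive (lift_is_additive (u : K -> zmodule A)).

Lemma free_liftU (u : K -> A) k : free_lift u << k >> = u k.
Proof. by rewrite /= liftU scale1r. Qed.

Lemma free_hom_eq (phi psi : {additive {freeg K} -> A}) :
  (forall k, phi << k >> = psi << k >>) -> forall D, phi D = psi D.
Proof.
move=> h D; rewrite -[D]freeg_sumE !raddf_sum; apply: eq_bigr => p _.
by rewrite -[coeff p D]intz -freegU_mulz !raddfMz h.
Qed.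

End FreeGroupLift.

Section PartialData.
Variable G : zmodType.

Definition FG : zmodType := {freeg (upairs G)}.

Definition gen_pair (g h : G) : FG := << upair g h >>.

Definition RG : set FG := [set r | exists g h k : G,
  r = gen_pair g h + gen_pair (g + h) k - gen_pair h k - gen_pair g (h + k)].

Definition ZG : zmodType := {quot (gen_group RG)}.

Variable S : set (upairs G).

Lemma FS_subgroup : subgroup_set [set D : FG | forall p, p \in dom D -> S p].
Proof.
split=> [p|D E hD hE p]; first by rewrite dom0.
by move=> /domB; rewrite mem_cat => /orP[/hD|/hE].
Qed.

(* F_S, as the subgroup of F_G of elements supported in S *)
Definition FS : zmodType := subgrp (zsub FS_subgroup).

Definition FS_incl : {additive FS -> FG} := \val.

Definition RS : set FS := [set r | RG (FS_incl r)].

Definition ZS : zmodType := {quot (gen_group RS)}.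

Lemma fS_subproof (x : FS) :
  x \in gen_group RS -> (cls (gen_group RG) \o FS_incl) x = 0.
Proof.
move=> hx; apply/kerP; apply: gen_min hx => y Ry; apply/kerP => /=.
by rewrite -(raddf0 (cls (gen_group RG))); apply/cls_eq; rewrite subr0 mem_gen.
Qed.

Definition fS : {additive ZS -> ZG} := qlift fS_subproof.

Definition KS : zmodType := subgrp (ker_group fS).
Definition IS : zmodType := subgrp (im_group fS).
Definition CS : zmodType := {quot (im_group fS)}.

Definition KS_incl : {additive KS -> ZS} := \val.
Definition IS_incl : {additive IS -> ZG} := \val.

Definition fS_im (z : ZS) : IS :=
  in_subgrp (introT (imP fS _) (ex_intro _ z erefl)).

Lemma fS_im_additive : zmod_morphism fS_im.
Proof. by move=> x y; apply: val_inj; exact: (raddfB fS). Qed.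

Definition fSI : {additive ZS -> IS} := mk_additive fS_im_additive.

Lemma fSI_onto : onto fSI.
Proof.
move=> [y hy]; have /imP[x fx] := hy.
by exists x; apply: val_inj.
Qed.

Lemma gen_S_subproof (s : S) : << val s >> \in zsub FS_subgroup.
Proof.
apply/zsubP => p /=; rewrite domU1 inE => /eqP ->.
by apply: set_mem; exact: (valP s).
Qed.

Definition gen_S (s : S) : ZS := cls (gen_group RS) (in_subgrp (gen_S_subproof s)).

Lemma fS_gen s : fS (gen_S s) = cls (gen_group RG) << val s >>.
Proof. by rewrite /fS /gen_S qliftE. Qed.

Lemma ZS_hom_eq (A : zmodType) (phi psi : {additive ZS -> A}) :
  (forall s, phi (gen_S s) = psi (gen_S s)) -> forall z, phi z = psi z.
Proof.
move=> h z; rewrite -[z]cls_repr; move: (repr z) => D {z}.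
pose u p : FS := if pselect (S p) is left Sp then
  in_subgrp (gen_S_subproof (SigSub (mem_set Sp))) else 0.
have -> : D = \sum_(p <- dom (FS_incl D)) u p *~ coeff p (FS_incl D).
  apply: val_inj; rewrite -[LHS]freeg_sumE raddf_sum big_seq [RHS]big_seq.
  apply: eq_bigr => p pD; rewrite raddfMz /u.
  have /zsubP/(_ p pD) Sp := valP D.
  by case: pselect => // Sp' /=; rewrite freegU_mulz intz.
rewrite !raddf_sum; apply: eq_bigr => p _; rewrite !raddfMz; congr (_ *~ _).
rewrite /u; case: pselect => [Sp|_]; last by rewrite !raddf0.
exact: (h (SigSub (mem_set Sp))).
Qed.

End PartialData.

Section CocyclesAsHom.
Variables G A : zmodType.

Lemma on_upair_cocycle (c : Z2sym G A) g h :
  on_upair (cocycle c) (upair g h) = cocycle c g h.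
Proof. by apply: on_upairE; case: (cocycleP c). Qed.

Lemma hom_of_subproof (c : Z2sym G A) x :
  x \in gen_group (@RG G) -> free_lift (on_upair (cocycle c)) x = 0.
Proof.
move=> hx; apply/kerP; apply: gen_min hx => _ [g [h [k ->]]]; apply/kerP.
rewrite !(raddfB, raddfD) !free_liftU !on_upair_cocycle.
by rewrite (cocycleP c).2 addrAC addrK subrr.
Qed.

Lemma hom_of_additive :
  zmod_morphism (fun c : Z2sym G A => qlift (@hom_of_subproof c) : Hom _ A).
Proof.
move=> c d; apply: hom_eq => x; rewrite -[x]cls_repr.
change (qlift (@hom_of_subproof (c - d)) (cls _ (repr x)) =
  qlift (@hom_of_subproof c) (cls _ (repr x)) -
  qlift (@hom_of_subproof d) (cls _ (repr x))).
rewrite !qliftE; pose u := free_lift (on_upair (cocycle c)).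
pose v := free_lift (on_upair (cocycle d)).
apply: (free_hom_eq (psi := u \- v)) => p.
change (free_lift (on_upair (cocycle (c - d))) << p >> = u << p >> - v << p >>).
by rewrite /u /v !free_liftU.
Qed.

(* The identification Z^2_sym(G, A) = Hom(Z_G, A). *)
Definition hom_of : {additive Z2sym G A -> Hom (ZG G) A} :=
  mk_additive hom_of_additive.

Lemma hom_ofE c g h : hom_of c (cls _ (gen_pair g h)) = cocycle c g h.
Proof.
by rewrite -on_upair_cocycle -(free_liftU (on_upair _)) -(qliftE (@hom_of_subproof c)).
Qed.

Lemma hom_of_inj : injective hom_of.
Proof.
move=> c d h; apply/val_inj/funext=> g; apply/funext=> k.
by rewrite -!/(cocycle _) -!hom_ofE h.
Qed.

Lemma hom_of_onto : onto hom_of.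
Proof.
move=> psi; pose c g h := psi (cls _ (gen_pair g h)).
have hc : sym_cocycle c.
  split=> [g h|g h k]; rewrite /c.
    by congr (psi (cls _ << _ >>)); apply/upair_eq; right.
  rewrite -!raddfD; congr (psi _); apply/cls_eq/mem_gen.
  by exists g, h, k; rewrite opprD addrA.
exists (mk_cocycle hc); apply: hom_eq => z; rewrite -[z]cls_repr.
apply: (free_hom_eq (phi := hom_of (mk_cocycle hc) \o cls _)
  (psi := psi \o cls _)) => p.
by elim/upair_ind: p => g h; exact: hom_ofE.
Qed.

End CocyclesAsHom.

Section Sequences.
Variables (G A : zmodType) (S : set (upairs G)).

Definition restr (c : Z2sym G A) : S -> A :=
  fun s => on_upair (cocycle c) (val s).

Lemma restrB c d : restr (c - d) = restr c - restr d.
Proof. by []. Qed.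

Lemma B2S_subgroup : subgroup_set [set b | exists2 c, c \in B2 G A & b = restr c].
Proof.
split; first by exists 0; rewrite ?rpred0.
by move=> _ _ [c hc ->] [d hd ->]; exists (c - d); rewrite ?rpredB ?restrB.
Qed.

Definition B2S : zmodClosed (S -> A) := zsub B2S_subgroup.

Lemma funZ_additive :
  zmod_morphism (fun (phi : Hom (ZS S) A) (s : S) => phi (gen_S s)).
Proof. by []. Qed.

Definition funZ : {additive Hom (ZS S) A -> (S -> A)} :=
  mk_additive funZ_additive.

Lemma funZ_inj : injective funZ.
Proof.
move=> phi psi h; apply/hom_eq/ZS_hom_eq => s.
exact: (congr1 (fun u : S -> A => u s) h).
Qed.

Definition HomI_incl : {additive Hom (IS S) A -> Hom (ZS S) A} :=
  precomp A (fSI S).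

Lemma HomI_incl_inj : injective HomI_incl.
Proof.
move=> phi psi h; apply: hom_eq => y; have [x <-] := fSI_onto y.
exact: (congr1 (fun u : Hom (ZS S) A => u x) h).
Qed.

(* B^2_S(A) regarded in Hom(Z_S, A) and in Hom(I_S, A): nothing is lost by   *)
(* taking preimages along these embeddings (lemma B2S_sub_HomI).             *)
Definition B2S_Z : zmodClosed (Hom (ZS S) A) := preim_group funZ B2S.
Definition B2S_I : zmodClosed (Hom (IS S) A) := preim_group HomI_incl B2S_Z.

(* Restriction Z^2_sym(G, A) = Hom(Z_G, A) -> Hom(I_S, A). *)
Definition restrI : {additive Z2sym G A -> Hom (IS S) A} :=
  precomp A (IS_incl S) \o hom_of G A.

Lemma restrIE c : funZ (HomI_incl (restrI c)) = restr c.
Proof.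
apply/funext=> s.
have -> : funZ (HomI_incl (restrI c)) s = hom_of G A c (fS S (gen_S s)) by [].
rewrite fS_gen /restr; elim/upair_ind: (val s) => g h.
by rewrite -/(gen_pair g h) hom_ofE on_upair_cocycle.
Qed.

(* The preimage B2S_I is all of B^2_S(A). *)
Lemma B2S_sub_HomI b :
  b \in B2S -> exists2 phi, phi \in B2S_I & b = funZ (HomI_incl phi).
Proof.
move=> hb; have /zsubP[c _ bE] := hb.
by exists (restrI c); rewrite ?mem_preim restrIE -bE.
Qed.

Lemma B2S_I_restr phi :
  phi \in B2S_I -> exists2 c, c \in B2 G A & phi = restrI c.
Proof.
rewrite !mem_preim => /zsubP[c hc e]; exists c => //.
by apply/HomI_incl_inj/funZ_inj; rewrite restrIE.
Qed.

Definition HomI_mod_B2S : zmodType := {quot B2S_I}.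
Definition H2S : zmodType := {quot B2S_Z}.

Lemma infl_subproof phi : phi \in B2S_I -> (cls B2S_Z \o HomI_incl) phi = 0.
Proof.
rewrite mem_preim -[_ phi]subr0 => /cls_eq h.
by rewrite -(raddf0 (cls B2S_Z)).
Qed.

Definition infl : {additive HomI_mod_B2S -> H2S} := qlift infl_subproof.

Lemma resK_subproof phi : phi \in B2S_Z -> precomp A (KS_incl S) phi = 0.
Proof.
rewrite mem_preim => /B2S_sub_HomI[psi _ /funZ_inj ->].
apply: hom_eq => k.
have -> : precomp A (KS_incl S) (HomI_incl psi) k = psi (fSI S (val k)) by [].
have -> : fSI S (val k) = 0 by apply/val_inj/kerP/(valP k).
exact: raddf0.
Qed.

Definition resK : {additive H2S -> Hom (KS S) A} := qlift resK_subproof.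

Lemma resExt_subproof c : c \in B2 G A -> (cls B2S_I \o restrI) c = 0.
Proof.
move=> hc; rewrite -(raddf0 (cls B2S_I)); apply/cls_eq; rewrite subr0.
by rewrite !mem_preim restrIE; apply/zsubP; exists c.
Qed.

Definition resExt : {additive Ext G A -> HomI_mod_B2S} := qlift resExt_subproof.

End Sequences.

(* For 0 -> I -> Z -> Z / I -> 0 and phi : I -> A, the class of the          *)
(* extension of Z / I by A pushed out along phi; its factor set is           *)
(* (x, y) |-> phi (s x + s y - s (x + y)) for a set-theoretic section s of   *)
(* Z -> Z / I. The class does not depend on s (lemma connectE).              *)
Section Connecting.
Variables (Z A : zmodType) (I : zmodClosed Z).
Implicit Types phi : Hom (subgrp I) A.

Lemma factor_subproof (s : {quot I} -> Z) (sK : cancel s (cls I)) x y :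
  s x + s y - s (x + y) \in I.
Proof. by apply/cls_eq; rewrite raddfD !sK. Qed.

Definition factor s (sK : cancel s (cls I)) x y : subgrp I :=
  in_subgrp (factor_subproof sK x y).

Lemma push_subproof s (sK : cancel s (cls I)) phi :
  sym_cocycle (fun x y => phi (factor sK x y)).
Proof.
have [fC fA] := cobound_sym_cocycle s.
split=> [x y|x y z]; first by congr (phi _); apply/val_inj/fC.
by rewrite -!raddfD; congr (phi _); apply/val_inj/fA.
Qed.

Definition push s (sK : cancel s (cls I)) phi : Z2sym {quot I} A :=
  mk_cocycle (push_subproof sK phi).

Lemma connect_additive :
  zmod_morphism (fun phi => cls (B2 _ A) (push (@cls_repr _ I) phi)).
Proof. by move=> phi psi; rewrite -raddfB; congr (cls _ _); apply: val_inj. Qed.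

Definition connect : {additive Hom (subgrp I) A -> Ext {quot I} A} :=
  mk_additive connect_additive.

Lemma connectE s (sK : cancel s (cls I)) phi :
  connect phi = cls (B2 _ A) (push sK phi).
Proof.
have dI x : repr x - s x \in I by apply/cls_eq; rewrite cls_repr sK.
apply/cls_eq/zsubP; exists (fun x => phi (in_subgrp (dI x))) => //.
apply/val_inj/funext=> x; apply/funext=> y.
change (phi (in_subgrp (dI x)) + phi (in_subgrp (dI y)) -
    phi (in_subgrp (dI (x + y))) =
  phi (factor (@cls_repr _ I) x y) - phi (factor sK x y)).
rewrite -raddfD -!raddfB; congr (phi _); apply: val_inj => /=.
change (repr x - s x + (repr y - s y) - (repr (x + y) - s (x + y)) =
  repr x + repr y - repr (x + y) - (s x + s y - s (x + y))).
by rewrite addrACA -opprD (opprD (repr (x + y))) addrACA -(opprD (s x + s y)).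
Qed.

Lemma connect_ext (psi : Hom Z A) :
  connect (precomp A (\val : subgrp I -> Z) psi) = 0.
Proof.
rewrite -(raddf0 (cls _)); apply/cls_eq; rewrite subr0; apply/zsubP.
exists (fun x => psi (repr x)) => //; apply/val_inj/funext=> x; apply/funext=> y.
change (psi (repr x) + psi (repr y) - psi (repr (x + y)) =
  psi (repr x + repr y - repr (x + y))).
by rewrite raddfB raddfD.
Qed.

End Connecting.

Section ConnS.
Variables (G A : zmodType) (S : set (upairs G)).

Lemma conn_subproof phi :
  phi \in B2S_I A S -> connect A (im_group (fS S)) phi = 0.
Proof. by move=> /B2S_I_restr[c _ ->]; exact: connect_ext. Qed.

Definition conn : {additive HomI_mod_B2S A S -> Ext (CS S) A} :=
  qlift conn_subproof.

End ConnS.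

(* Main.v *)
(* Sending {g, h} to <<g>> + <<h>> - <<g + h>> embeds Z_G into the free abelian
   group on G: the free group maps to the extension of G by Z_G whose factor set
   is the universal symmetric cocycle, and the composite restricted to Z_G is the
   inclusion of the kernel of this extension. Subgroups of free abelian groups
   are projective, so I_S and Z_G are projective. Hence Z_S -> I_S splits, which
   gives the first sequence and its splitting, and every symmetric cocycle on
   Z_G is a coboundary, which makes the connecting map onto; the rest of the
   second sequence is formal. *)
From HB Require Import structures.
Require Import Defs.
From mathcomp Require Import all_boot all_algebra.
From mathcomp Require Import boolp classical_sets functions.
From mathcomp Require Import freeg.
Set Implicit Arguments.
Unset Strict Implicit.
Unset Printing Implicit Defensive.
Import GRing.Theory.
Local Open Scope ring_scope.
Local Open Scope classical_set_scope.

(** * Projectivity of subgroups of free abelian groups, by Zorn's lemma *)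

Section KernelComplement.
Variables (K : choiceType) (E : zmodType) (q : {additive E -> {freeg K}}).

Definition supported (Y : set K) (e : E) :=
  forall x, coeff x (q e) != 0 -> Y x.

Definition zset (F : set (K + E)) : set E := [set c | c = 0 \/ F (inr c)].

(* [F] encodes a set [Y] of basis elements together with a complement [zset F]
   of [ker q] in the preimage of the span of [Y]; the element [0] is added by
   [zset] so that the empty set is such a pair. *)
Definition partial_compl (F : set (K + E)) :=
  [/\ subgroup_set (zset F),
      forall c, zset F c -> supported (F \o inl) c,
      forall c, zset F c -> q c = 0 -> c = 0
    & forall e, supported (F \o inl) e -> exists2 c, zset F c & q c = q e].

Lemma partial_compl0 : partial_compl set0.
Proof.
split=> [|c [->|//] x|c [->|//] //|e se].
- by split=> [|x y [->|//] [->|//]]; [left | left; rewrite subr0].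
- by rewrite raddf0 coeff0 eqxx.
- exists 0; [by left | rewrite raddf0].
  apply/eqP; rewrite eq_sym; apply/freeg_eqP => x; rewrite coeff0.
  by apply/eqP/negPn/negP => /se.
Qed.

(** Two elements of the union lie in a common member of the chain, and the finite support of any
    [q e] is covered by a single member. *)
Lemma partial_compl_bigcup (P : set (set (K + E))) :
  P `<=` partial_compl -> total_on P subset ->
  partial_compl (\bigcup_(F in P) F).
Proof.
move=> Pc Pt; set U := \bigcup_(F in P) F.
(* Adjoining [set0] provides a member for the element 0 and for empty supports even if the chain is
   empty. *)
pose Q F := F = set0 \/ P F.
have Qc F : Q F -> partial_compl F by case=> [->|/Pc//]; exact: partial_compl0.
have Qt F F' : Q F -> Q F' -> F `<=` F' \/ F' `<=` F.
  case=> [->|PF]; first by left.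
  by case=> [->|PF']; [right | exact: Pt].
have QU F : Q F -> F `<=` U by case=> [-> //|PF t Ft]; exists F.
have zS F F' : F `<=` F' -> zset F `<=` zset F'.
  by move=> FF' c [->|/FF']; [left | right].
have sS (F F' : set (K + E)) e :
    F `<=` F' -> supported (F \o inl) e -> supported (F' \o inl) e.
  by move=> FF' se x /se/FF'.
have zU c : zset U c -> exists2 F, Q F & zset F c.
  case=> [->|[F PF Fc]]; first by exists set0; left.
  by exists F; right.
split.
- split; first by left.
  move=> x y /zU[F QF Fx] /zU[F' QF' Fy].
  have [H [QH Hx Hy]] : exists H, [/\ Q H, zset H x & zset H y].
    case: (Qt _ _ QF QF') => s; [exists F' | exists F]; split=> //.
    - exact: zS Fx.
    - exact: zS Fy.
  have [[_ HB] _ _ _] := Qc _ QH.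
  exact: (zS _ _ (QU _ QH) _ (HB _ _ Hx Hy)).
- move=> c /zU[F QF Fc]; have [_ Fs _ _] := Qc _ QF.
  exact: sS (QU _ QF) (Fs _ Fc).
- by move=> c /zU[F /Qc[_ _ Fk _]]; exact: Fk.
- move=> e se.
  have {se} : forall x, x \in dom (q e) -> (U \o inl) x.
    by move=> x; rewrite mem_dom => /se.
  have fin (s : seq K) : (forall x, x \in s -> (U \o inl) x) ->
      exists2 F, Q F & forall x, x \in s -> F (inl x).
    elim: s => [_|x s IHs xs]; first by exists set0 => //; left.
    have [|F QF Fs] := IHs; first by move=> y ys; apply: xs; rewrite inE ys orbT.
    have [F' PF' F'x] : (U \o inl) x by apply: xs; rewrite mem_head.
    have QF' : Q F' by right.
    have [FF'|F'F] := Qt _ _ QF QF'; [exists F' | exists F] => // y.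
      by rewrite inE => /orP[/eqP->//|/Fs/FF'].
    by rewrite inE => /orP[/eqP->|/Fs//]; exact: F'F.
  case/fin=> F QF Fs; have [_ _ _ Fe] := Qc _ QF.
  have [|c Fc qc] := Fe e; first by move=> x; rewrite -mem_dom => /Fs.
  by exists c => //; exact: zS (QU _ QF) _ Fc.
Qed.

(* The coefficients at the new basis element [x] form a subgroup of [int], so
   it is enough to add to the complement one element realizing the smallest
   positive coefficient. *)
Lemma partial_compl_extend (F : set (K + E)) (x : K) :
  partial_compl F -> ~ F (inl x) ->
  exists F', [/\ partial_compl F', F `<=` F' & F' (inl x)].
Proof.
move=> [[F0 FB] Fs Fk Fe] Fx; pose Y y := F (inl y) \/ y = x.
have sY e : supported (F \o inl) e -> supported Y e by move=> se y /se; left.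
have Y0 e y : supported Y e -> ~ Y y -> coeff y (q e) = 0.
  by move=> se nY; apply/eqP/negPn/negP => /se.
have sF e : supported Y e -> coeff x (q e) = 0 -> supported (F \o inl) e.
  move=> se qx y /[dup] h /se[//|yx].
  by move: h; rewrite yx [coeff x _]qx eqxx.
have Fx0 c : zset F c -> coeff x (q c) = 0.
  by move=> /Fs sc; apply/eqP/negPn/negP => /sc.
(* The new complement is [zset F] plus the multiples of [e0]. The first clause lets it reach every
   coefficient at [x]; the second keeps its intersection with the kernel trivial. *)
suff [e0 se0 gen] : exists2 e0, supported Y e0 &
    (forall e, supported Y e -> exists n : int,
      coeff x (q (e - e0 *~ n)) = 0) /\
    (forall n : int, coeff x (q (e0 *~ n)) = 0 -> e0 *~ n = 0).
  pose C c := exists2 b, zset F b & exists n : int, c = b + e0 *~ n.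
  pose F' t := match t with inl y => Y y | inr c => C c end.
  have C0 : C 0 by exists 0; [left | exists 0; rewrite mulr0z addr0].
  have zC c : zset F' c <-> C c.
    by split=> [[->|]|] //; right.
  exists F'; split; last by right.
  - split.
    + split=> [|c d /zC[b Fb [n ->]] /zC[b' Fb' [n' ->]]]; first by left.
      apply/zC; exists (b - b'); first exact: FB.
      by exists (n - n'); rewrite mulrzBr opprD addrACA.
    + move=> c /zC[b Fb [n ->]] y; rewrite raddfD raddfMz coeffD raddfMz /= => h.
      apply: contrapT => nY.
      by rewrite (Y0 _ _ (sY _ (Fs _ Fb)) nY) (Y0 _ _ se0 nY) mul0rz addr0 eqxx in h.
    + move=> c /zC[b Fb [n ->]] qc.
      have en : e0 *~ n = 0.
        by apply: gen.2; rewrite -(coeff0 _ x) -qc raddfD coeffD (Fx0 _ Fb) add0r.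
      by rewrite en addr0 in qc *; exact: Fk.
    + move=> e se; have [n en] := gen.1 e se.
      have [|c Fc qc] := Fe (e - e0 *~ n).
        apply: sF => // y; rewrite raddfB raddfMz coeffB raddfMz /= => h.
        apply: contrapT => nY.
        by rewrite (Y0 _ _ se nY) (Y0 _ _ se0 nY) mul0rz subr0 eqxx in h.
      exists (c + e0 *~ n); last by rewrite raddfD qc -raddfD subrK.
      by apply/zC; exists c => //; exists n.
  - by case=> [y Fy|c Fc]; [left | exists c; [right|exists 0; rewrite mulr0z addr0]].
have [e0|none] :=
  pselect (exists e, supported Y e /\ coeff x (q e) != 0); last first.
  (* All coefficients at [x] vanish, so nothing has to be added. *)
  exists 0; first by move=> y; rewrite raddf0 coeff0 eqxx.
  split=> [e se|n _]; last by rewrite mul0rz.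
  exists 0; rewrite mulr0z subr0; apply/eqP/negPn/negP => qx.
  by apply: none; exists e.
pose p d := `[< exists e, supported Y e /\ coeff x (q e) = (Posz d.+1) >].
have exd : exists d, p d.
  case: e0 => e [se]; case E0 : (coeff x (q e)) => [[|d]|d] // _.
    by exists d; apply/asboolP; exists e.
  exists d; apply/asboolP; exists (- e); split.
    by move=> y; rewrite raddfN coeffN oppr_eq0 => /se.
  by rewrite raddfN coeffN E0.
case: (ex_minnP exd) => d /asboolP[e1 [se1 qe1]] mind.
exists e1 => //; split=> [e se|n]; last first.
  rewrite raddfMz [LHS]raddfMz /= qe1 => /eqP.
  by rewrite mulrz_eq0 orbF => /eqP->; rewrite mulr0z.
pose a : int := coeff x (q e); exists (a %/ d.+1)%Z.
have -> : coeff x (q (e - e1 *~ (a %/ d.+1)%Z)) = (a %% d.+1)%Z.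
  rewrite raddfB raddfMz coeffB [coeff x (_ *~ _)]raddfMz /= qe1 -/a.
  by rewrite {1}(divz_eq a d.+1) -mulrzl intz addrAC subrr add0r.
(* A positive remainder would itself be a coefficient at [x], below the least positive one
   [d.+1]. *)
case E1 : (a %% d.+1)%Z => [[|r]|r] //.
  have : (a %% d.+1)%Z < d.+1 by apply: ltz_pmod.
  rewrite E1 ltz_nat ltnS ltnNge mind //; apply/asboolP.
  exists (e - e1 *~ (a %/ d.+1)%Z); split.
    move=> y; rewrite raddfB raddfMz coeffB raddfMz /= => h.
    apply: contrapT => nY.
    by rewrite (Y0 _ _ se nY) (Y0 _ _ se1 nY) mul0rz subr0 eqxx in h.
  rewrite raddfB raddfMz coeffB [coeff x (_ *~ _)]raddfMz /= qe1 -/a -E1.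
  by rewrite {1}(divz_eq a d.+1) -mulrzl intz addrAC subrr add0r.
by have := modz_ge0 a (isT : d.+1%:Z != 0); rewrite E1.
Qed.

(** A maximal pair contains every basis element, since otherwise it could be extended; hence every
    [e] is supported in it. *)
Lemma kernel_complement : exists C : set E, [/\ subgroup_set C,
  forall c, C c -> q c = 0 -> c = 0 & forall e, exists2 c, C c & q c = q e].
Proof.
have [F [cF maxF]] := Zorn_bigcup partial_compl_bigcup.
have [F0 _ Fk Fe] := cF.
exists (zset F); split=> // e; apply: Fe => x _; apply: contrapT => Fx.
have [F' [cF' FF' F'x]] := partial_compl_extend cF Fx.
by apply: (maxF F') => //; split=> // /(_ _ F'x).
Qed.

End KernelComplement.

(** As [j] is injective, a complement of the kernel of [j \o p] is one of the kernel of [p]; [p]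
    maps it bijectively onto [Z], and the inverse is the section. *)
Lemma freeg_sub_section (K : choiceType) (Z E : zmodType)
    (j : {additive Z -> {freeg K}}) (p : {additive E -> Z}) :
  injective j -> onto p -> exists s : {additive Z -> E}, cancel s p.
Proof.
move=> injj ontop.
have [C [[C0 CB] Ck Ce]] := kernel_complement (j \o p).
have sec z : exists c, C c /\ p c = z.
  have [e <-] := ontop z; have [c Cc pc] := Ce e.
  by exists c; split=> //; exact: injj.
pose s z := sval (cid (sec z)).
have Cs z : C (s z) by rewrite /s; case: cid => ? [].
have ps z : p (s z) = z by rewrite /s; case: cid => ? [].
suff sB : zmod_morphism s by exists (mk_additive sB).
(* The defect of additivity lies both in [C] and in the kernel. *)
move=> z w; apply/subr0_eq/Ck; first by do 2?apply: (CB).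
by rewrite /= (raddfB p) (raddfB p) !ps subrr raddf0.
Qed.

(** * The abelian extension defined by a symmetric cocycle *)

(* The extension of [U] by [A] with factor set [c]; as [c] need not be
   normalized, its neutral element is [(- c 0 0, 0)]. *)
Definition cocycle_ext (U A : zmodType) (c : Z2sym U A) : Type := (A * U)%type.

Section ExtensionGroup.
Variables (U A : zmodType) (c : Z2sym U A).

Lemma cocycleC x y : cocycle c x y = cocycle c y x.
Proof. exact: (cocycleP c).1. Qed.

Lemma cocycle0l x : cocycle c 0 x = cocycle c 0 0.
Proof.
have := (cocycleP c).2 0 0 x; rewrite !add0r.
by rewrite [RHS]addrC => /addIr.
Qed.

HB.instance Definition _ := Choice.on (cocycle_ext c).

Definition ext_zero : cocycle_ext c := (- cocycle c 0 0, 0).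
Definition ext_add (x y : cocycle_ext c) : cocycle_ext c :=
  (x.1 + y.1 + cocycle c x.2 y.2, x.2 + y.2).
Definition ext_opp (x : cocycle_ext c) : cocycle_ext c :=
  (- x.1 - cocycle c x.2 (- x.2) - cocycle c 0 0, - x.2).

Lemma ext_addA : associative ext_add.
Proof.
move=> [a x] [b y] [d z]; rewrite /ext_add /=; congr (_, _); last exact: addrA.
have := (cocycleP c).2 x y z; set p := cocycle c x y; set r := cocycle c _ z.
set s := cocycle c y z => E.
by rewrite -!addrA; do 2!congr (_ + _); rewrite (addrCA p) E.
Qed.

Lemma ext_addC : commutative ext_add.
Proof. by move=> x y; rewrite /ext_add (addrC x.1) cocycleC (addrC x.2). Qed.

Lemma ext_add0 : left_id ext_zero ext_add.
Proof.
move=> [a x]; rewrite /ext_add /= add0r cocycle0l.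
by rewrite addrAC addNr add0r.
Qed.

Lemma ext_addN : left_inverse ext_zero ext_opp ext_add.
Proof.
move=> [a x]; rewrite /ext_add /ext_zero /= addNr (cocycleC (- x)).
by congr (_, _); rewrite -opprD -(addrA _ a) addrAC addNr add0r.
Qed.

HB.instance Definition _ :=
  GRing.isZmodule.Build (cocycle_ext c) ext_addA ext_addC ext_add0 ext_addN.

Lemma ext_proj_additive : zmod_morphism (snd : cocycle_ext c -> U).
Proof. by []. Qed.

Definition ext_proj : {additive cocycle_ext c -> U} := mk_additive ext_proj_additive.

(** The shift by [cocycle c 0 0] sends 0 to the neutral element and makes the map additive. *)
Definition ext_inj_fun (a : A) : cocycle_ext c := (a - cocycle c 0 0, 0).

Lemma ext_injE a x : ext_inj_fun a + x = (a + x.1, x.2).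
Proof.
case: x => b x; rewrite [LHS]/(_ + _) /= /ext_add /= cocycle0l add0r.
by rewrite (addrAC a) subrK.
Qed.

Lemma ext_inj_additive : zmod_morphism ext_inj_fun.
Proof.
move=> a b; apply/(canRL (addrK _)); rewrite addrC ext_injE /=.
by rewrite addrA (addrC b) subrK.
Qed.

Definition ext_inj : {additive A -> cocycle_ext c} :=
  mk_additive ext_inj_additive.

Lemma ext_inj_injective : injective ext_inj.
Proof. by move=> a b -[/addIr]. Qed.

Definition ext_sect (x : U) : cocycle_ext c := (0, x).

(** Pushed into the extension, [c] becomes the coboundary of the section. *)
Lemma ext_sectD x y :
  ext_sect x + ext_sect y = ext_inj (cocycle c x y) + ext_sect (x + y).
Proof.
rewrite [RHS]ext_injE /= addr0.
by rewrite [LHS]/(_ + _) /= /ext_add /= !add0r.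
Qed.

End ExtensionGroup.

(** * Embedding of [ZG G] into the free group on [G] *)

Section FreeZG.
Variable G : zmodType.

(* Under this map the universal cocycle becomes the coboundary of the
   tautological map from [G] to the free group on [G]. *)
Definition ZG_freeg : {additive ZG G -> {freeg G}} :=
  hom_of G _ (cobound (fun g : G => << g >> : {freeg G})).

Lemma ZG_freegE g h :
  ZG_freeg (cls _ (gen_pair g h)) = << g >> + << h >> - << g + h >>.
Proof. exact: hom_ofE. Qed.

Lemma ZG_freeg_inj : injective ZG_freeg.
Proof.
(* The universal cocycle [c] corresponds to the identity of [ZG G]. *)
have [c cE] := @hom_of_onto G _ (idfun : {additive ZG G -> ZG G}).
have {}cE g h : cocycle c g h = cls _ (gen_pair g h) by rewrite -hom_ofE cE.
pose l := free_lift (ext_sect c).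
(* Both sides are additive and agree on generators by [ext_sectD]. *)
have li z : l (ZG_freeg z) = ext_inj c z.
  rewrite -[z]cls_repr; apply: (free_hom_eq (phi := l \o ZG_freeg \o cls _)
    (psi := ext_inj c \o cls _)) => p.
  elim/upair_ind: p => g h.
  change (l (ZG_freeg (cls _ (gen_pair g h))) = ext_inj c (cls _ (gen_pair g h))).
  rewrite ZG_freegE raddfB raddfD !free_liftU -cE.
  by apply/(canLR (addrK _)); rewrite ext_sectD.
by move=> z w zw; apply: (@ext_inj_injective _ _ c); rewrite -!li zw.
Qed.

Lemma ZG_sub_section (Z E : zmodType) (j : {additive Z -> ZG G})
    (p : {additive E -> Z}) :
  injective j -> onto p -> exists s : {additive Z -> E}, cancel s p.
Proof.
move=> injj; apply: (@freeg_sub_section _ _ _ (ZG_freeg \o j)).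
exact: inj_comp ZG_freeg_inj injj.
Qed.

(** Projectivity splits the extension with factor set [c]; additivity of the splitting exhibits [c]
    as the coboundary of minus its [A]-component. *)
Lemma ZG_cocycle_cobound (A : zmodType) (c : Z2sym (ZG G) A) : c \in B2 _ A.
Proof.
have [s sK] : exists s : {additive ZG G -> cocycle_ext c}, cancel s (ext_proj c).
  apply: (@ZG_sub_section _ _ idfun) => // z; by exists (ext_sect c z).
apply/zsubP; exists (fun z => - (s z).1) => //.
apply/val_inj/funext=> z; apply/funext=> w.
change (- (s z).1 - (s w).1 + - - (s (z + w)).1 = cocycle c z w).
rewrite opprK raddfD.
have -> : (s z + s w).1 = (s z).1 + (s w).1 + cocycle c (s z).2 (s w).2 by [].
rewrite [(s z).2]sK [(s w).2]sK -opprD addrA.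
by rewrite addNr add0r.
Qed.

End FreeZG.

(** * The first sequence and its splitting *)

Section Exactness.
Variables (G A : zmodType) (S : set (upairs G)).

Lemma fSI_KS (k : KS S) : fSI S (KS_incl S k) = 0.
Proof. exact/val_inj/kerP/(valP k). Qed.

Lemma ZS_section : exists s : {additive IS S -> ZS S}, cancel s (fSI S).
Proof. exact: (ZG_sub_section (j := IS_incl S)) val_inj (@fSI_onto _ _). Qed.

Lemma sub_section_ker (s : {additive IS S -> ZS S}) (sK : cancel s (fSI S)) z :
  z - s (fSI S z) \in ker_group (fS S).
Proof.
apply/kerP; have -> (x : ZS S) : fS S x = val (fSI S x) by [].
by rewrite raddfB sK subrr.
Qed.

(** A section [s] of [fSI S] gives the projection [z - s (fSI S z)] onto the kernel. *)
Lemma ZS_retraction : exists r : {additive ZS S -> KS S}, cancel (KS_incl S) r.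
Proof.
have [s sK] := ZS_section.
have kr := sub_section_ker sK.
have rB : zmod_morphism (fun z => in_subgrp (kr z) : KS S).
  move=> x y; apply: val_inj.
  change (x - y - s (fSI S (x - y)) = x - s (fSI S x) - (y - s (fSI S y))).
  by rewrite !raddfB addrACA -opprD.
exists (mk_additive rB) => k; apply: val_inj.
change (KS_incl S k - s (fSI S (KS_incl S k)) = KS_incl S k).
by rewrite fSI_KS raddf0 subr0.
Qed.

Lemma infl_cls phi : infl A S (cls _ phi) = cls _ (HomI_incl A S phi).
Proof. exact: qliftE. Qed.

Lemma resK_cls phi : resK A S (cls _ phi) = precomp A (KS_incl S) phi.
Proof. exact: qliftE. Qed.

Lemma infl_injective : injective (infl A S).
Proof.
move=> x y; rewrite -[x]cls_repr -[y]cls_repr !infl_cls => /cls_eq h.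
by apply/cls_eq; rewrite mem_preim raddfB.
Qed.

Lemma exact_infl_resK : exact_at (infl A S) (resK A S).
Proof.
move=> h; rewrite -[h]cls_repr; move: (repr h) => phi {h}.
have [s sK] := ZS_section.
apply/imP/kerP => [[q ->]|].
  rewrite -[q]cls_repr; move: (repr q) => psi {q}.
  rewrite infl_cls resK_cls; apply: hom_eq => k.
  change (psi (fSI S (KS_incl S k)) = 0).
  by rewrite fSI_KS raddf0.
rewrite resK_cls => phiK.
(* Since [phi] kills the kernel, it factors through [fSI S] as [phi \o s]. *)
exists (cls _ (precomp A s phi)); rewrite infl_cls; congr (cls _ _).
apply: hom_eq => z; apply/subr0_eq.
have -> : HomI_incl A S (precomp A s phi) z = phi (s (fSI S z)) by [].
rewrite -raddfB.
have kz := sub_section_ker sK z.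
exact: (congr1 (fun u : Defs.Hom (KS S) A => u (in_subgrp kz)) phiK).
Qed.

Lemma split_epi_resK : split_epi (resK A S).
Proof.
have [r rK] := ZS_retraction.
(* Homomorphisms on the kernel extend to [ZS S] along the retraction [r]. *)
exists (cls (B2S_Z A S) \o precomp A r : {additive _ -> _}) => psi.
rewrite [LHS]resK_cls; apply: hom_eq => k /=.
by rewrite [r _]rK.
Qed.

Lemma split_epi_onto (U V : zmodType) (g : {additive U -> V}) :
  split_epi g -> onto g.
Proof. by case=> s sK y; exists (s y). Qed.

End Exactness.

(** * Kernel and surjectivity of the connecting map for a subgroup [I] of [Z] *)

Section ConnectingExact.
Variables (Z A : zmodType) (I : zmodClosed Z).
Implicit Types phi : Defs.Hom (subgrp I) A.

Lemma connect_eq0 phi :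
  Defs.connect A I phi = 0 -> exists psi : Defs.Hom Z A, phi = precomp A \val psi.
Proof.
rewrite -(raddf0 (cls (B2 _ A))) => /cls_eq; rewrite subr0 => /zsubP[al _ alE].
have alD x y : al x + al y - al (x + y) = phi (factor (@cls_repr _ I) x y).
  exact: (congr1 (fun c : Z2sym _ A => cocycle c x y) alE).
have dI z : z - repr (cls I z) \in I by apply/cls_eq; rewrite cls_repr.
(* Split [z] into its [I]-part and its representative, and let [al] give the value on the latter. *)
pose psi z := phi (in_subgrp (dI z)) + al (cls I z).
have psiB : zmod_morphism psi.
  suff psiD z w : psi (z + w) = psi z + psi w.
    by move=> z w; apply/(canRL (addrK _)); rewrite -psiD subrK.
  have := alD (cls I z) (cls I w); rewrite -raddfD => alzw.
  apply/esym/subr0_eq; rewrite /psi.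
  have shuffle (a b x y u v : A) :
    a + x + (b + y) - (u + v) = a + b - u + (x + y - v).
    by rewrite (addrACA a) opprD (addrACA (a + b)).
  rewrite shuffle alzw -raddfD -raddfB -raddfD.
  rewrite -(raddf0 phi).
  congr (phi _); apply: val_inj.
  set p := repr (cls I z); set q := repr (cls I w).
  change (z - p + (w - q) - (z + w - repr (cls I (z + w))) +
    (p + q - repr (cls I z + cls I w)) = 0).
  rewrite (raddfD (cls I)) (addrACA z) -opprD opprB (addrC (z + w - _)).
  by rewrite [X in X + _]addrA subrK addrA subrK subrr.
exists (mk_additive psiB); apply: hom_eq => i.
have ci : cls I (val i) = cls I 0 by apply/cls_eq; rewrite subr0; exact: (valP i).
have ai : al (cls I (val i)) = al (cls I 0) by rewrite ci.
change (phi i = psi (val i)).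
(* Neither [al] nor the representative need vanish at the zero class; subtracting [psi 0] cancels
   both. *)
rewrite -[val i]subr0 psiB /psi ai opprD addrACA subrr addr0 -raddfB.
congr (phi _); apply: val_inj.
change (val i = val i - repr (cls I (val i)) - (0 - repr (cls I 0))).
by rewrite ci sub0r opprK subrK.
Qed.

(** The pullback to [Z] of a cocycle on the quotient is a coboundary; up to a constant, the bounding
    function is additive on [I], and this gives the preimage. *)
Lemma connect_onto :
  (forall c : Z2sym Z A, c \in B2 Z A) -> onto (Defs.connect A I).
Proof.
move=> Z2B e; rewrite -[e]cls_repr; move: (repr e) => {e}c.
pose p := cls I.
(* With this sign, [b] on representatives bounds the factor set pushed along [phi] minus [c]. *)
have hc : sym_cocycle (fun z w => - cocycle c (p z) (p w)).
  have [cC cE] := cocycleP c.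
  split=> [z w|z w t]; first by rewrite cC.
  by rewrite -!opprD !(raddfD p) cE.
have /zsubP[b _ bE] := Z2B (mk_cocycle hc).
have {bE}bD z w : b z + b w - b (z + w) = - cocycle c (p z) (p w).
  exact: (congr1 (fun c : Z2sym _ A => cocycle c z w) bE).
have p0 (i : subgrp I) : p (val i) = 0.
  by rewrite -(raddf0 p); apply/cls_eq; rewrite subr0; exact: (valP i).
pose c0 := cocycle c 0 0.
(* When one argument lies in [I], the pulled-back cocycle has the constant value [- c0]; adding [c0]
   corrects for it. *)
pose phi (i : subgrp I) := b (val i) + c0.
have bI z (i : subgrp I) : b (z + val i) = b z + phi i.
  have := bD z (val i); rewrite p0 cocycleC cocycle0l -/c0 => E.
  by rewrite /phi addrA -[c0]opprK -E opprB addrC subrK.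
have phiB : zmod_morphism phi.
  suff phiD i j : phi (i + j) = phi i + phi j.
    by move=> i j; apply/(canRL (addrK _)); rewrite -phiD subrK.
  by rewrite {1}/phi raddfD bI addrAC.
clearbody phi.
exists (mk_additive phiB); apply/cls_eq/zsubP.
exists (fun x => b (repr x)) => //.
apply/val_inj/funext=> x; apply/funext=> y.
change (b (repr x) + b (repr y) - b (repr (x + y)) =
  phi (factor (@cls_repr _ I) x y) - cocycle c x y).
have := bD (repr x) (repr y); rewrite /p !cls_repr => <-.
have -> : repr x + repr y = repr (x + y) + val (factor (@cls_repr _ I) x y).
  by rewrite [val _]/(repr x + repr y - repr (x + y)) [RHS]addrC subrK.
by rewrite bI opprD [RHS]addrC !addrA subrK.
Qed.

End ConnectingExact.

(** * The second sequence *)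

Section ExtSequence.
Variables (G A : zmodType) (S : set (upairs G)).

Lemma resExt_cls c : resExt A S (cls _ c) = cls _ (restrI A S c).
Proof. exact: qliftE. Qed.

Lemma conn_cls phi : conn A S (cls _ phi) = Defs.connect A (im_group (fS S)) phi.
Proof. exact: qliftE. Qed.

(** A homomorphism killed by the connecting map extends to [ZG G], and such an extension is a
    symmetric cocycle on [G]. *)
Lemma exact_resExt_conn : exact_at (resExt A S) (conn A S).
Proof.
move=> h; rewrite -[h]cls_repr; move: (repr h) => phi {h}.
apply/imP/kerP => [[e ->]|].
  rewrite -[e]cls_repr; move: (repr e) => c {e}.
  by rewrite resExt_cls conn_cls; exact: connect_ext.
rewrite conn_cls => /connect_eq0[psi ->].
have [c <-] := hom_of_onto psi.
by exists (cls _ c); rewrite resExt_cls.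
Qed.

Lemma conn_onto : onto (conn A S).
Proof.
move=> e; have [|phi <-] := connect_onto (I := im_group (fS S)) _ e.
  exact: ZG_cocycle_cobound.
by exists (cls _ phi); rewrite conn_cls.
Qed.

Lemma resExt_eq0 c : resExt A S (cls _ c) = 0 <-> restr c \in B2S A S.
Proof.
rewrite resExt_cls -(raddf0 (cls (B2S_I A S))) cls_eq subr0.
by rewrite !mem_preim restrIE.
Qed.

End ExtSequence.

Theorem theorem19 (G : zmodType) (S : set (upairs G)) (A : zmodType) :
  [/\ injective (infl A S),
      exact_at (infl A S) (resK A S),
      onto (resK A S)
    & split_epi (resK A S)] /\
  [/\ exact_at (resExt A S) (conn A S),
      onto (conn A S)
    & forall e : Ext G A,
        resExt A S e = 0 <->
        exists2 c : Z2sym G A, restr c \in B2S A S & e = cls (B2 G A) c].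
Proof.
split.
  have splitK := @split_epi_resK G A S.
  split=> //; [exact: infl_injective | exact: exact_infl_resK |].
  exact: split_epi_onto.
split=> [||e]; [exact: exact_resExt_conn | exact: conn_onto |].
split=> [|[c rc ->]]; last exact/resExt_eq0.
by rewrite -[e]cls_repr => /resExt_eq0 rc; exists (repr e).
Qed.
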